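(* Let $(g,m_0,m_1)$ be one of the triples $(1,m_0,m_0)$, $(2,m_0,m_1)$, $(3,1,1)$, $(3,2,2)$, $(3,4,4)$, $(3,8,8)$, $(4,m_0,1)$, $(4,2,2)$, $(6,1,1)$, $(6,2,2)$, where $m_0,m_1$ are positive integers, with $m_0\le m_1$ in the case $(2,m_0,m_1)$. The spectral problem $$\xi''(x)+\tfrac12\big(m_0-m_1+(2-(m_0+m_1))\tanh(x)\big)\xi'(x)-\tfrac12\big(m_0+m_1-(m_0-m_1)\tanh(x)\big)\xi(x)+\Big(\lambda+\frac{m_0+m_1}{2g}\Big)\frac{\xi(x)}{\cosh^2(x)}=0,\qquad x\in\mathbb{R},$$ describing the equivariant stability of the identity map of the special orthogonal group, parametrized by $r(x)=\frac1g\arctan(e^x)$, is solved by $$\xi_j(x)=\frac{1}{\cosh(x)}\,P^{\left(\frac{m_1+1}{2},\frac{m_0+1}{2}\right)}_{j-1}\big(\tanh(x)\big),\qquad \lambda_j=-\frac{m_0+m_1}{2g}+j\Big(j+\frac{m_0+m_1}{2}\Big),$$ where $j\in\{1,2,3,\dots\}$.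
   Context: Origin of the problem: an isometric cohomogeneity one action $G\times\mathbb{S}^{n+1}\to\mathbb{S}^{n+1}$ with data $(g,m_0,m_1)$ ($g$ the number of distinct principal curvatures of the principal orbits, $m_0,m_1$ their alternating multiplicities, $n=\frac{g(m_0+m_1)}{2}$) lifts to an isometric cohomogeneity one action of $G\times\mathrm{SO}(n+1)$ on $\mathrm{SO}(n+2)$. Equivariant self-maps of $\mathrm{SO}(n+2)$ given by a function $r$ on $[0,\frac{\pi}{2g}]$ have Jacobi equation $$\ddot\xi+\big(m_0-m_1+(m_0+m_1)\cos(2gt)\big)\tfrac{g}{\sin(2gt)}\dot\xi-\tfrac{g}{\sin^2(2gt)}\Big[(2g-2)\cos(2(r(t)-t))\big(m_0+m_1+(m_0-m_1)\cos(2gt)\big)+2\cos(2(r(t)-t)+2gt)\big(m_0-m_1+(m_0+m_1)\cos(2gt)\big)\Big]\xi+\lambda\xi=0.$$ For $r(t)=t$ (the identity map) the change of variables $t=\frac1g\arctan(e^x)$, with $\lambda$ rescaled by the factor $4g^2$, gives the spectral problem of the claim. $P_k^{(\alpha,\beta)}$, $k\ge 0$, denotes the Jacobi polynomial of degree $k$, a polynomial solution of $(1-y^2)f''(y)+\big(\beta-\alpha-(\alpha+\beta+2)y\big)f'(y)+k(k+1+\alpha+\beta)f(y)=0$, namely $P_k^{(\alpha,\beta)}(y)=\frac{(\alpha+1)_k}{k!}\,{}_2F_1\big(-k,k+1+\alpha+\beta;\alpha+1;\tfrac{1-y}{2}\big)$. *)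

(* Defs.v *)
From Stdlib Require Import Reals Factorial Lra Lia.
From Coquelicot Require Import Coquelicot.

Set Implicit Arguments.
Open Scope R_scope.

Definition admissible (g m0 m1 : nat) : Prop :=
  (0 < m0)%nat /\ (0 < m1)%nat /\
  (   (g = 1%nat /\ m1 = m0)
   \/ (g = 2%nat /\ (m0 <= m1)%nat)
   \/ (g = 3%nat /\ m0 = 1%nat /\ m1 = 1%nat)
   \/ (g = 3%nat /\ m0 = 2%nat /\ m1 = 2%nat)
   \/ (g = 3%nat /\ m0 = 4%nat /\ m1 = 4%nat)
   \/ (g = 3%nat /\ m0 = 8%nat /\ m1 = 8%nat)
   \/ (g = 4%nat /\ m1 = 1%nat)
   \/ (g = 4%nat /\ m0 = 2%nat /\ m1 = 2%nat)
   \/ (g = 6%nat /\ m0 = 1%nat /\ m1 = 1%nat)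
   \/ (g = 6%nat /\ m0 = 2%nat /\ m1 = 2%nat)).

(* Rising factorial (a)_n = a (a + 1) ... (a + n - 1). *)
Fixpoint pochhammer (a : R) (n : nat) : R :=
  match n with
  | O => 1
  | S p => pochhammer a p * (a + INR p)
  end.

(* Gauss series; when a = -k the coefficients vanish from index k + 1 on, so
   the series is a polynomial in z. *)
Definition hyp2F1 (a b c z : R) : R :=
  PSeries (fun i => pochhammer a i * pochhammer b i
                    / (pochhammer c i * INR (fact i))) z.

Definition jacobiP (alpha beta : R) (k : nat) (y : R) : R :=
  pochhammer (alpha + 1) k / INR (fact k)
  * hyp2F1 (- INR k) (INR k + 1 + alpha + beta) (alpha + 1) ((1 - y) / 2).

(* [Derive_n] is total, so twice differentiability on R is required explicitly.
   As usual for a spectral problem, the zero function is not a solution. *)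
Definition solves_spectral_problem (g m0 m1 : nat) (xi : R -> R) (lambda : R)
    : Prop :=
  (exists x : R, xi x <> 0) /\
  forall x : R,
    ex_derive_n xi 1 x /\ ex_derive_n xi 2 x /\
    Derive_n xi 2 x
    + 1 / 2 * (INR m0 - INR m1 + (2 - (INR m0 + INR m1)) * tanh x)
        * Derive_n xi 1 x
    - 1 / 2 * (INR m0 + INR m1 - (INR m0 - INR m1) * tanh x) * xi x
    + (lambda + (INR m0 + INR m1) / (2 * INR g)) * (xi x / (cosh x) ^ 2)
    = 0.

Definition xi_ (m0 m1 j : nat) (x : R) : R :=
  1 / cosh x
  * jacobiP ((INR m1 + 1) / 2) ((INR m0 + 1) / 2) (j - 1) (tanh x).

Definition lambda_ (g m0 m1 j : nat) : R :=
  - ((INR m0 + INR m1) / (2 * INR g))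
  + INR j * (INR j + (INR m0 + INR m1) / 2).

(* Main.v *)
Require Import Defs.
From Stdlib Require Import Reals Factorial Lra Lia.
From Coquelicot Require Import Coquelicot.

Open Scope R_scope.

(** Writing [y = tanh x] and [xi x = f y / cosh x], one has [y' = 1 - y^2] and
    [(1 / cosh)' = - y / cosh], so the left side of the spectral equation for [xi] is
    [(1 - y^2) / cosh x] times that of the Jacobi equation for [f] with parameters
    [((m1 + 1) / 2, (m0 + 1) / 2)] and degree [j - 1].  The Jacobi equation is
    the hypergeometric equation, which amounts to the two-term recurrence of
    the coefficients of the Gauss series.  Finally [f 1 <> 0] and [tanh] gets
    arbitrarily close to [1], hence [xi] is not identically zero. *)

Lemma pochhammer_pos (a : R) (n : nat) : 0 < a -> 0 < pochhammer a n.
Proof.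
  intros Ha; induction n as [|n IH]; simpl.
  - lra.
  - apply Rmult_lt_0_compat; [exact IH|].
    pose proof (pos_INR n); lra.
Qed.

Lemma pochhammer_opp_INR (k n : nat) :
  (k < n)%nat -> pochhammer (- INR k) n = 0.
Proof.
  induction n as [|n IH]; intros Hk; [lia|]; simpl.
  destruct (Nat.eq_dec k n) as [->|Hn].
  - ring.
  - rewrite IH by lia; ring.
Qed.

(** Repeats the summand of [hyp2F1] verbatim, so that [jacobiP] is convertible to a multiple of a
    [PSeries] with these coefficients. *)
Definition gauss_coef (a b c : R) (i : nat) : R :=
  pochhammer a i * pochhammer b i / (pochhammer c i * INR (fact i)).

Lemma gauss_coef_S (a b c : R) (n : nat) :
  0 < c ->
  INR (S n) * (c + INR n) * gauss_coef a b c (S n)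
  = (a + INR n) * (b + INR n) * gauss_coef a b c n.
Proof.
  intros Hc; unfold gauss_coef.
  rewrite fact_simpl, mult_INR; cbn [pochhammer].
  pose proof (pochhammer_pos c n Hc) as Hp.
  pose proof (INR_fact_lt_0 n) as Hf.
  pose proof (pos_INR n) as Hn.
  pose proof (lt_0_INR (S n) ltac:(lia)) as HS.
  field; repeat split; lra.
Qed.

(** For every [r] the terms [a n * r ^ n] are bounded by the finite sum of the absolute values up to
    index [k], so every real [r] is a lower bound of the radius. *)
Lemma CV_radius_eventually_0 (a : nat -> R) (k : nat) :
  (forall n, (k < n)%nat -> a n = 0) -> CV_radius a = p_infty.
Proof.
  intros Ha.
  destruct (CV_radius_bounded a) as [Hub _].
  assert (Hle : forall r : R, Rbar_le r (CV_radius a)).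
  { intros r; apply Hub.
    exists (sum_f_R0 (fun i => Rabs (a i * r ^ i)) k); intros n.
    destruct (Nat.le_gt_cases n k) as [Hn|Hn].
    - clear Ha; induction k as [|k IH].
      + replace n with 0%nat by lia; simpl; lra.
      + rewrite tech5; destruct (Nat.eq_dec n (S k)) as [->|].
        * pose proof (cond_pos_sum (fun i => Rabs (a i * r ^ i)) k
            (fun i => Rabs_pos _)); lra.
        * pose proof (Rabs_pos (a (S k) * r ^ S k)).
          specialize (IH ltac:(lia)); lra.
    - rewrite Ha, Rmult_0_l, Rabs_R0 by exact Hn.
      apply cond_pos_sum; intros i; apply Rabs_pos. }
  destruct (CV_radius a) as [l| |].
  - specialize (Hle (l + 1)); simpl in Hle; lra.
  - reflexivity.
  - destruct (Hle 0).
Qed.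

(** The coefficient of [z ^ n] on the left is [(n+1)(c+n) u(n+1) - (a+n)(b+n) u(n)], because
    [n(n-1) + (a+b+1)n + ab = (a+n)(b+n)]. *)
Lemma hypergeometric_equation (u : nat -> R) (a b c z : R) :
  (forall n, INR (S n) * (c + INR n) * u (S n)
             = (a + INR n) * (b + INR n) * u n) ->
  Rbar_lt (Rabs z) (CV_radius u) ->
  z * (1 - z) * PSeries (PS_derive (PS_derive u)) z
  + (c - (a + b + 1) * z) * PSeries (PS_derive u) z
  - a * b * PSeries u z = 0.
Proof.
  intros Hrec Hz.
  set (d := PS_derive u); set (e := PS_derive d).
  assert (Hu : ex_pseries u z) by (apply CV_radius_inside; exact Hz).
  assert (Hd : ex_pseries d z)
    by (apply CV_radius_inside; unfold d; rewrite CV_radius_derive; exact Hz).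
  assert (He : ex_pseries e z)
    by (apply CV_radius_inside; unfold e, d; rewrite !CV_radius_derive; exact Hz).
  assert (Hexs : forall l (v : nat -> R), ex_pseries v z -> ex_pseries (PS_scal l v) z)
    by (intros l v; apply ex_pseries_scal; apply Rmult_comm).
  assert (Hexi : forall v : nat -> R, ex_pseries v z -> ex_pseries (PS_incr_1 v) z)
    by (intros v; apply ex_pseries_incr_1).
  (* Collect the left side into one power series; each factor [z] becomes a shift [PS_incr_1]. *)
  transitivity (PSeries
    (PS_plus (PS_plus (PS_incr_1 e) (PS_scal (-1) (PS_incr_1 (PS_incr_1 e))))
       (PS_plus (PS_plus (PS_scal c d) (PS_scal (- (a + b + 1)) (PS_incr_1 d)))
          (PS_scal (- (a * b)) u))) z).
  - rewrite !PSeries_plus by auto 7 using ex_pseries_plus.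
    rewrite !PSeries_scal, !PSeries_incr_1; ring.
  - rewrite <- (PSeries_const_0 z); apply PSeries_ext; intros n.
    pose proof (Hrec n) as Hn.
    unfold PS_plus, PS_scal, PS_incr_1, plus, scal, zero, e, d, PS_derive.
    (* The double shift pads with zeros at indices 0 and 1, which are therefore separate cases. *)
    destruct n as [|[|n]]; cbn -[INR]; unfold mult; cbn -[INR];
      rewrite ?S_INR, ?INR_0 in *; lra.
Qed.

(** Substitute [z = (1 - y) / 2]: then [1 - y^2 = 4 z (1 - z)], and each derivative in [y] brings a
    factor [-1/2]. *)
Lemma jacobiP_solution (alpha beta : R) (k : nat) :
  0 < alpha + 1 ->
  exists f1 f2 : R -> R, forall y,
    is_derive (jacobiP alpha beta k) y (f1 y) /\
    is_derive f1 y (f2 y) /\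
    (1 - y ^ 2) * f2 y + (beta - alpha - (alpha + beta + 2) * y) * f1 y
    + INR k * (INR k + 1 + alpha + beta) * jacobiP alpha beta k y = 0.
Proof.
  intros Hc.
  set (b := INR k + 1 + alpha + beta).
  set (u := gauss_coef (- INR k) b (alpha + 1)).
  set (K := pochhammer (alpha + 1) k / INR (fact k)).
  assert (Hu : CV_radius u = p_infty).
  { apply (CV_radius_eventually_0 u k); intros n Hn; unfold u, gauss_coef.
    rewrite pochhammer_opp_INR by exact Hn; unfold Rdiv; ring. }
  (* The derivative has the same shape with new [C] and [v], so this serves for both derivatives. *)
  assert (Hder : forall v : nat -> R, CV_radius v = p_infty -> forall C y,
    is_derive (fun t => C * PSeries v ((1 - t) / 2)) y
      (- C / 2 * PSeries (PS_derive v) ((1 - y) / 2))).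
  { intros v Hv C y.
    pose proof (is_derive_PSeries v ((1 - y) / 2)
      ltac:(rewrite Hv; exact I)) as H.
    evar_last.
    - apply is_derive_scal, (is_derive_comp (PSeries v) (fun t => (1 - t) / 2)).
      + exact H.
      + auto_derive; [exact I|reflexivity].
    - unfold scal; simpl; unfold mult; simpl; field. }
  exists (fun y => - K / 2 * PSeries (PS_derive u) ((1 - y) / 2)),
    (fun y => - (- K / 2) / 2 * PSeries (PS_derive (PS_derive u)) ((1 - y) / 2)).
  intros y; split; [|split].
  - exact (Hder u Hu K y).
  - apply Hder; rewrite CV_radius_derive; exact Hu.
  - pose proof (hypergeometric_equation u (- INR k) b (alpha + 1) ((1 - y) / 2)
      (fun n => gauss_coef_S (- INR k) b (alpha + 1) n Hc)
      ltac:(rewrite Hu; exact I)) as H.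
    change (jacobiP alpha beta k y) with (K * PSeries u ((1 - y) / 2)).
    apply (Rmult_eq_compat_l K) in H; rewrite Rmult_0_r in H.
    rewrite <- H; unfold b; field.
Qed.

(** At [y = 1] the Gauss series is evaluated at 0 and equals 1, leaving the positive prefactor. *)
Lemma jacobiP_1_neq_0 (alpha beta : R) (k : nat) :
  0 < alpha + 1 -> jacobiP alpha beta k 1 <> 0.
Proof.
  intros Hc; unfold jacobiP, hyp2F1.
  replace ((1 - 1) / 2) with 0 by field.
  rewrite PSeries_0; simpl.
  pose proof (pochhammer_pos (alpha + 1) k Hc).
  pose proof (INR_fact_lt_0 k).
  replace (1 * 1 / (1 * 1)) with 1 by field; rewrite Rmult_1_r.
  apply Rgt_not_eq, Rdiv_lt_0_compat; assumption.
Qed.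

Lemma cosh_gt_0 (x : R) : 0 < cosh x.
Proof.
  unfold cosh; pose proof (exp_pos x); pose proof (exp_pos (- x)); lra.
Qed.

Lemma cosh2_tanh2 (x : R) : 1 / cosh x ^ 2 = 1 - tanh x ^ 2.
Proof.
  pose proof (cosh_gt_0 x) as Hc.
  assert (H : cosh x ^ 2 - sinh x ^ 2 = 1).
  { unfold cosh, sinh.
    assert (He : exp x * exp (- x) = 1)
      by (rewrite <- exp_plus, Rplus_opp_r; apply exp_0).
    nra. }
  rewrite <- H at 1; unfold tanh; field; lra.
Qed.

Lemma is_derive_tanh (x : R) : is_derive tanh x (1 - tanh x ^ 2).
Proof.
  pose proof (cosh_gt_0 x) as Hc.
  evar_last.
  - apply is_derive_div.
    + apply is_derive_Reals, derivable_pt_lim_sinh.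
    + apply is_derive_Reals, derivable_pt_lim_cosh.
    + lra.
  - unfold tanh; field; lra.
Qed.

Lemma is_derive_sech (x : R) :
  is_derive (fun t => 1 / cosh t) x (- (1 / cosh x * tanh x)).
Proof.
  pose proof (cosh_gt_0 x) as Hc.
  evar_last.
  - apply is_derive_div.
    + apply is_derive_const.
    + apply is_derive_Reals, derivable_pt_lim_cosh.
    + lra.
  - unfold tanh, zero; simpl; field; lra.
Qed.

(** The derivative is again [1 / cosh] times a function of [tanh], so the rule can be iterated. *)
Lemma is_derive_sech_mul_tanh (f : R -> R) (f' x : R) :
  is_derive f (tanh x) f' ->
  is_derive (fun t => 1 / cosh t * f (tanh t)) x
    (1 / cosh x * (- tanh x * f (tanh x) + (1 - tanh x ^ 2) * f')).
Proof.
  intros Hf; evar_last.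
  - apply (is_derive_mult (fun t => 1 / cosh t) (fun t => f (tanh t))).
    + apply is_derive_sech.
    + apply (is_derive_comp f tanh); [exact Hf|apply is_derive_tanh].
    + apply Rmult_comm.
  - unfold plus, scal; simpl; unfold mult; simpl; ring.
Qed.

Lemma tanh_near_1 (eps : R) : 0 < eps -> exists x, Rabs (tanh x - 1) < eps.
Proof.
  intros He.
  (* For [x = ln v] the distance to 1 is [2 / (v^2 + 1)]; this [v] gives [2 = eps * (v - 1)], and
     [v - 1 < v^2 + 1]. *)
  set (v := 2 / eps + 1).
  assert (Hq : 0 < 2 / eps) by (apply Rdiv_lt_0_compat; lra).
  assert (Hv : 1 < v) by (unfold v; lra).
  exists (ln v); unfold tanh, sinh, cosh.
  rewrite exp_Ropp, exp_ln by lra.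
  assert (Hv2 : 0 < v * v + 1) by nra.
  replace ((v - / v) / 2 / ((v + / v) / 2) - 1) with (- (2 / (v * v + 1)))
    by (field; nra).
  rewrite Rabs_Ropp, Rabs_pos_eq
    by (apply Rlt_le, Rdiv_lt_0_compat; lra).
  apply (Rmult_lt_reg_r (v * v + 1)); [exact Hv2|].
  replace (2 / (v * v + 1) * (v * v + 1)) with (eps * (v - 1))
    by (unfold v; field; nra).
  apply Rmult_lt_compat_l; nra.
Qed.

Theorem proposition4p7 (g m0 m1 : nat) (Hadm : admissible g m0 m1)
    (j : nat) (Hj : (1 <= j)%nat) :
  solves_spectral_problem g m0 m1 (xi_ m0 m1 j) (lambda_ g m0 m1 j).
Proof.
  clear Hadm.
  set (al := (INR m1 + 1) / 2); set (be := (INR m0 + 1) / 2).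
  assert (Hal : 0 < al + 1) by (unfold al; pose proof (pos_INR m1); lra).
  set (f := jacobiP al be (j - 1)).
  destruct (jacobiP_solution al be (j - 1) Hal) as (f1 & f2 & Hf).
  fold f in Hf.
  set (F1 := fun y => - y * f y + (1 - y ^ 2) * f1 y).
  set (F2 := fun y => - f y - y * f1 y - 2 * y * f1 y + (1 - y ^ 2) * f2 y).
  assert (HF1 : forall y, is_derive F1 y (F2 y)).
  { intros y; destruct (Hf y) as (H1 & H2 & _); unfold F1, F2.
    auto_derive.
    - repeat split; eexists; eassumption.
    - rewrite (is_derive_unique (fun t : R => f t) y _ H1),
        (is_derive_unique (fun t : R => f1 t) y _ H2); ring. }
  assert (D1 : forall x, is_derive (xi_ m0 m1 j) x (1 / cosh x * F1 (tanh x)))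
    by (intros x; apply (is_derive_sech_mul_tanh f), (Hf (tanh x))).
  assert (D2 : forall x, is_derive (Derive_n (xi_ m0 m1 j) 1) x
    (1 / cosh x * (- tanh x * F1 (tanh x) + (1 - tanh x ^ 2) * F2 (tanh x)))).
  { intros x.
    apply (is_derive_ext (fun t => 1 / cosh t * F1 (tanh t))).
    - intros t; symmetry; apply is_derive_unique, D1.
    - apply is_derive_sech_mul_tanh, HF1. }
  split.
  (* [tanh] never takes the value 1, so continuity of [f] carries its nonvanishing at 1 to a nearby
     value of [tanh]. *)
  - destruct (Hf 1) as (Hf1 & _).
    assert (Hcont : continuity_pt f 1).
    { apply continuity_pt_filterlim.
      apply (ex_derive_continuous (V := R_NormedModule)).
      eexists; exact Hf1. }
    destruct (continuous_neq_0 f 1 Hcont (jacobiP_1_neq_0 al be (j - 1) Hal))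
      as [eps Heps].
    destruct (tanh_near_1 eps (cond_pos eps)) as [x Hx].
    exists x; apply Rmult_integral_contrapositive_currified.
    + pose proof (cosh_gt_0 x).
      apply Rgt_not_eq, Rdiv_lt_0_compat; lra.
    + replace (tanh x) with (1 + (tanh x - 1)) by ring.
      apply Heps; exact Hx.
  - intros x; split; [|split].
    + eexists; apply D1.
    + eexists; apply D2.
    + change (Derive_n (xi_ m0 m1 j) 2 x) with
        (Derive (Derive_n (xi_ m0 m1 j) 1) x).
      rewrite (is_derive_unique _ _ _ (D2 x)).
      change (Derive_n (xi_ m0 m1 j) 1 x) with (Derive (xi_ m0 m1 j) x).
      rewrite (is_derive_unique _ _ _ (D1 x)).
      replace (xi_ m0 m1 j x / cosh x ^ 2)
        with (xi_ m0 m1 j x * (1 - tanh x ^ 2))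
        by (rewrite <- cosh2_tanh2; unfold Rdiv; ring).
      change (xi_ m0 m1 j x) with (1 / cosh x * f (tanh x)).
      destruct (Hf (tanh x)) as (_ & _ & Hode).
      (* With [M = (m0 + m1) / 2] the Jacobi eigenvalue is [(j - 1)(j + 1 + M) = j (j + M) - 1 - M];
         the [1 + M] is made up by differentiating the factor [1 / cosh] and by the zeroth-order
         term. *)
      rewrite minus_INR in Hode by exact Hj.
      apply (Rmult_eq_compat_l (1 / cosh x * (1 - tanh x ^ 2))) in Hode.
      rewrite Rmult_0_r in Hode; rewrite <- Hode.
      unfold F1, F2, lambda_, al, be; change (INR 1) with 1.
      generalize (1 / cosh x) (INR m0) (INR m1); intros s p q.
      (* This quotient cancels against the one in [lambda_]; kept opaque, it spares [field] a
         division by [g]. *)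
      generalize ((p + q) / (2 * INR g)); intros w.
      field.
Qed.
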